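(* Let $\operatorname{sm}$ and $\operatorname{cm}$ be the functions analytic near $0$ defined by $\operatorname{sm}'=\operatorname{cm}^2$, $\operatorname{cm}'=-\operatorname{sm}^2$, $\operatorname{sm}(0)=0$, $\operatorname{cm}(0)=1$. For a power series $f(u)=\sum_{\nu\ge0}c_\nu u^\nu/\nu!$ write $\int_0^\infty f(u)e^{-u/x}\,du:=\sum_{\nu\ge0}c_\nu\,\nu!\,x^{\nu+1}$. Then, as formal power series in $x$, $$\int_0^\infty \operatorname{sm}(u)e^{-u/x}du=\cfrac{x^2}{1+\cfrac{a_1x^3}{1+\cfrac{a_2x^3}{1+\ddots}}},\quad a_{2r-1}=(3r-2)(3r-1)^2,\ a_{2r}=(3r)^2(3r+1)\ (r\ge1);$$ $$\int_0^\infty \operatorname{cm}(u)e^{-u/x}du=\cfrac{x}{1+\cfrac{a_1x^3}{1+\cfrac{a_2x^3}{1+\ddots}}},\quad a_{2r-1}=(3r-2)^2(3r-1),\ a_{2r}=(3r-1)(3r)^2\ (r\ge1);$$ $$\int_0^\infty \operatorname{sm}(u)\operatorname{cm}(u)e^{-u/x}du=\cfrac{x^2}{1+\cfrac{a_1x^3}{1+\cfrac{a_2x^3}{1+\ddots}}},\quad a_{2r-1}=(3r-1)^2(3r),\ a_{2r}=(3r)(3r+1)^2\ (r\ge1).$$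
   Context: The integrals denote the formal transformation from exponential to ordinary generating functions given in the claim; continued fractions are formal power series in $x$.
   Formalization: For f(u) = Σ c_ν u^ν/ν! the transform is taken to be Σ c_ν x^{ν+1} instead of Σ c_ν ν! x^{ν+1}; with the printed formula the x^5 coefficient for sm would be −96 while the continued fraction gives −4. *)

(* Defs.v *)
From Stdlib Require Import Reals Lra Lia Arith.
From Coquelicot Require Import Coquelicot.

Open Scope C_scope.

(** * Formal power series in [x] over the complex numbers *)

Definition fps := nat -> C.

Definition fps_monomial (k : nat) : fps :=
  fun n => if Nat.eqb n k then 1 else 0.

Definition fps_one : fps := fps_monomial 0.

Definition fps_add (A B : fps) : fps := fun n => A n + B n.

Definition fps_scal (z : C) (A : fps) : fps := fun n => z * A n.

Definition fps_mul (A B : fps) : fps :=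
  fun n => sum_n (fun k => A k * B (n - k)%nat) n.

(** [fps_inv_upto A m] is correct in degrees [<= m]; its coefficient in
    degree [m + 1] is obtained by solving [A * B = 1] for [B (m + 1)]. *)
Fixpoint fps_inv_upto (A : fps) (m : nat) : fps :=
  match m with
  | O => fun _ => / A O
  | S m' => fun n =>
      if Nat.eqb n (S m')
      then - (/ A O * sum_n (fun i => A (S i) * fps_inv_upto A m' (m' - i)%nat) m')
      else fps_inv_upto A m' n
  end.

(** The inverse, meaningful when [A O <> 0]; see [fps_mul_inv]. *)
Definition fps_inv (A : fps) : fps := fun n => fps_inv_upto A n n.

Definition fps_div (A B : fps) : fps := fps_mul A (fps_inv B).

(** Convergence for the [x]-adic topology: every coefficient is eventually
    constant, equal to that of the limit. *)
Definition fps_lim (u : nat -> fps) (F : fps) : Prop :=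
  forall n : nat, exists N : nat, forall m : nat, (N <= m)%nat -> u m n = F n.

Lemma fps_inv_upto_stable (A : fps) (m n : nat) :
  (n <= m)%nat -> fps_inv_upto A m n = fps_inv A n.
Proof.
induction m as [|m IH]; intros Hn.
- replace n with 0%nat by lia. reflexivity.
- destruct (Nat.eq_dec n (S m)) as [->|Hne].
  + reflexivity.
  + simpl. rewrite (proj2 (Nat.eqb_neq _ _) Hne). apply IH. lia.
Qed.

Lemma fps_mul_inv (A : fps) (n : nat) :
  A O <> 0 -> fps_mul A (fps_inv A) n = fps_one n.
Proof.
intros HA. unfold fps_mul, fps_one, fps_monomial. destruct n as [|m].
- rewrite sum_O. unfold fps_inv; simpl. now apply Cinv_r.
- unfold sum_n. rewrite sum_Sn_m by lia. rewrite <- sum_n_m_S.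
  rewrite Nat.sub_0_r. simpl Nat.eqb. cbv iota.
  unfold fps_inv at 1. simpl fps_inv_upto. rewrite Nat.eqb_refl.
  unfold sum_n.
  rewrite (sum_n_m_ext_loc
             (fun i => A (S i) * fps_inv_upto A m (m - i)%nat)
             (fun i => A (S i) * fps_inv A (S m - S i)%nat)).
  + change (@plus _) with Cplus. field. exact HA.
  + intros k Hk. rewrite fps_inv_upto_stable by lia. reflexivity.
Qed.

(** * Continued fractions in [x ^ 3] *)

(** [1 + a_i x^3 / (1 + a_{i+1} x^3 / (... / (1 + a_{i+N-1} x^3)))] *)
Fixpoint cf_denominator (a : nat -> C) (N i : nat) : fps :=
  match N with
  | O => fps_one
  | S N' =>
      fps_add fps_one
        (fps_div (fps_scal (a i) (fps_monomial 3)) (cf_denominator a N' (S i)))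
  end.

Definition cf_convergent (k : nat) (a : nat -> C) (N : nat) : fps :=
  fps_div (fps_monomial k) (cf_denominator a N 1).

(** [F = x^k / (1 + a_1 x^3 / (1 + a_2 x^3 / (1 + ...)))]; [a 0] is unused. *)
Definition is_continued_fraction (k : nat) (a : nat -> C) (F : fps) : Prop :=
  fps_lim (cf_convergent k a) F.

(** * Power series expansions and the formal Laplace transform *)

(** [f u = sum_nu c_nu u^nu / nu!] for all complex [u] near [0]. *)
Definition has_expansion (f : C -> C) (c : nat -> C) : Prop :=
  locally (RtoC 0)
    (fun u : C => is_pseries (fun nu : nat => c nu / RtoC (INR (fact nu))) u (f u)).

Definition analytic_near_0 (f : C -> C) : Prop :=
  exists c : nat -> C, has_expansion f c.

(** The integral of [(u^nu / nu!) e^(-u/x)] over [u >= 0] is [x^(nu+1)], so the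
    exponential coefficients [c_nu] of [f] become the ordinary coefficients of
    [sum_nu c_nu x^(nu+1)]. *)
Definition formal_laplace (c : nat -> C) : fps :=
  fun n => match n with O => 0 | S nu => c nu end.

Definition is_laplace_transform (f : C -> C) (F : fps) : Prop :=
  exists c : nat -> C, has_expansion f c /\ F = formal_laplace c.

(* Main.v *)
Require Import Defs.
From Stdlib Require Import Reals Arith Lra Lia FunctionalExtensionality.
From Coquelicot Require Import Coquelicot.
Local Open Scope C_scope.

(** Let [S], [K] be the Taylor series of [sm], [cm]. From [S' = K^2], [K' = -S^2] one gets
    [S^3 + K^3 = 1], and then the third derivatives of the members of each of the families
    [S^(3r+1)], [S^(3r) K], [S^(3r+1) K] are combinations of three consecutive members.
    Since the Laplace transform turns [f'] into [(1/x) L f - f(0)], this gives three-term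
    recurrences in [x^3], that is, J-fractions for the first members; these are the even
    contractions of the stated S-fractions. The passage from functions to series is made on
    the real axis, separately for real and imaginary parts. *)

(** * The ring of formal power series *)

(** Why three derivations close up: modulo [c^3 = 1 - s^3] every monomial in [s], [c] is a
    polynomial in [s] times 1, [c] or [c^2]. Each derivation shifts the exponent of [c] by 2 and
    that of [s] by -1, both modulo 3, so the third one returns to the same family. Where the partial
    numerators come from: in the third derivative of [s^n] the coefficient of [s^n] is minus the sum
    of [n (n-1)^2] and [n (n+1)^2], and these two summands are consecutive numerators of the
    fraction for sm. The product of the two coefficients linking [s^n] and [s^(n+3)], namely
    [n (n+1) (n+2)] upwards and [(n+3) (n+2) (n+1)] downwards, is [n (n+1)^2] times [(n+2)^2 (n+3)],
    again two consecutive numerators. Such splittings of the diagonal and of the off-diagonal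
    products are exactly what makes a J-fraction the contraction of an S-fraction. The families with
    a factor [c] split in the same way. *)

Definition fps_zero : fps := fun _ => 0.
Definition fps_opp (A : fps) : fps := fun n => - A n.
Definition fps_sub (A B : fps) : fps := fps_add A (fps_opp B).
Definition fps_tail (A : fps) : fps := fun n => A (S n).

Declare Scope fps_scope.
Delimit Scope fps_scope with fps.
Bind Scope fps_scope with fps.
Infix "+" := fps_add : fps_scope.
Infix "-" := fps_sub : fps_scope.
Infix "*" := fps_mul : fps_scope.
Notation "- A" := (fps_opp A) : fps_scope.
Notation "0" := fps_zero : fps_scope.
Notation "1" := fps_one : fps_scope.
Notation "''X^' k" := (fps_monomial k) (at level 1, k at level 1, format "''X^' k") : fps_scope.

Lemma fps_mul_0 (A B : fps) : (A * B)%fps 0%nat = A 0%nat * B 0%nat.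
Proof. unfold fps_mul. now rewrite sum_O. Qed.

(** Peeling off the lowest coefficient makes the convolution recursive in the degree, so that the
    ring laws become inductions without reindexing of double sums. *)
Lemma fps_mul_S (A B : fps) (n : nat) :
  (A * B)%fps (S n) = A 0%nat * B (S n) + (fps_tail A * B)%fps n.
Proof.
unfold fps_mul, sum_n. rewrite sum_Sn_m by lia. now rewrite <- sum_n_m_S.
Qed.

Lemma fps_mul_S_r (A B : fps) (n : nat) :
  (A * B)%fps (S n) = (A * fps_tail B)%fps n + A (S n) * B 0%nat.
Proof.
unfold fps_mul. rewrite sum_Sn, Nat.sub_diag.
rewrite (sum_n_ext_loc _ (fun k => A k * fps_tail B (n - k)%nat)); [reflexivity|].
intros k Hk. unfold fps_tail. now replace (S n - k)%nat with (S (n - k)) by lia.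
Qed.

Lemma fps_mul_comm (A B : fps) : (A * B)%fps = (B * A)%fps.
Proof.
apply functional_extensionality; intro n.
revert A B; induction n as [|n IH]; intros A B.
- rewrite !fps_mul_0. ring.
- rewrite fps_mul_S, fps_mul_S_r, IH. ring.
Qed.

Lemma fps_mul_add_distr_r (A B D : fps) : ((A + B) * D)%fps = (A * D + B * D)%fps.
Proof.
apply functional_extensionality; intro n.
revert A B; induction n as [|n IH]; intros A B.
- unfold fps_add at 2. rewrite !fps_mul_0. unfold fps_add. ring.
- unfold fps_add at 2. rewrite !fps_mul_S.
  change (fps_tail (A + B)) with (fps_tail A + fps_tail B)%fps.
  rewrite IH. unfold fps_add. ring.
Qed.

Lemma fps_scal_mul (z : C) (A B : fps) : (fps_scal z A * B)%fps = fps_scal z (A * B)%fps.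
Proof.
apply functional_extensionality; intro n.
revert A; induction n as [|n IH]; intros A.
- unfold fps_scal at 2. rewrite !fps_mul_0. unfold fps_scal. ring.
- unfold fps_scal at 2. rewrite !fps_mul_S.
  change (fps_tail (fps_scal z A)) with (fps_scal z (fps_tail A)).
  rewrite IH. unfold fps_scal. ring.
Qed.

Lemma fps_mul_assoc (A B D : fps) : (A * (B * D))%fps = (A * B * D)%fps.
Proof.
apply functional_extensionality; intro n.
revert A B; induction n as [|n IH]; intros A B.
- rewrite !fps_mul_0. ring.
- rewrite !fps_mul_S.
  replace (fps_tail (A * B)) with (fps_scal (A 0%nat) (fps_tail B) + fps_tail A * B)%fps
    by (apply functional_extensionality; intro k; symmetry; apply fps_mul_S).
  rewrite fps_mul_add_distr_r, fps_scal_mul. unfold fps_add, fps_scal.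
  rewrite <- IH, fps_mul_0. ring.
Qed.

Lemma fps_mul_0_l (A : fps) : (0 * A)%fps = 0%fps.
Proof.
apply functional_extensionality; intro n; induction n as [|n IH].
- rewrite fps_mul_0. apply Cmult_0_l.
- rewrite fps_mul_S. change (fps_tail 0%fps) with fps_zero. rewrite IH.
  unfold fps_zero. ring.
Qed.

Lemma fps_mul_1_l (A : fps) : (1 * A)%fps = A.
Proof.
apply functional_extensionality; intro n; destruct n as [|n].
- rewrite fps_mul_0. apply Cmult_1_l.
- rewrite fps_mul_S. change (fps_tail 1%fps) with fps_zero. rewrite fps_mul_0_l.
  unfold fps_zero, fps_one, fps_monomial; simpl. ring.
Qed.

Lemma fps_ring_theory :
  ring_theory fps_zero fps_one fps_add fps_mul fps_sub fps_opp eq.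
Proof.
split; intros; try reflexivity;
  try (apply functional_extensionality; intro n; unfold fps_add, fps_opp, fps_zero; ring).
- apply fps_mul_1_l.
- apply fps_mul_comm.
- apply fps_mul_assoc.
- apply fps_mul_add_distr_r.
Qed.

Add Ring fps_ring : fps_ring_theory.

Definition fps_const (z : C) : fps := fps_scal z 1%fps.

Lemma fps_const_mul (z : C) (A : fps) : (fps_const z * A)%fps = fps_scal z A.
Proof. unfold fps_const. now rewrite fps_scal_mul, fps_mul_1_l. Qed.

Lemma fps_const_add (y z : C) : fps_const (y + z) = (fps_const y + fps_const z)%fps.
Proof.
apply functional_extensionality; intro n. unfold fps_const, fps_scal, fps_add. ring.
Qed.

Lemma fps_const_mult (y z : C) : fps_const (y * z) = (fps_const y * fps_const z)%fps.
Proof.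
rewrite fps_const_mul. apply functional_extensionality; intro n.
unfold fps_const, fps_scal. ring.
Qed.

Lemma fps_const_1 : fps_const 1 = 1%fps.
Proof. apply functional_extensionality; intro n. apply Cmult_1_l. Qed.

Lemma fps_const_inj (z : C) (A B : fps) :
  z <> 0 -> (fps_const z * A)%fps = (fps_const z * B)%fps -> A = B.
Proof.
intros Hz H. apply functional_extensionality; intro n.
apply (f_equal (fun F => / z * F n)) in H. rewrite !fps_const_mul in H.
unfold fps_scal in H. rewrite !Cmult_assoc, Cinv_l, !Cmult_1_l in H; trivial.
Qed.

Lemma fps_monomial_mul_lt (k : nat) (A : fps) (n : nat) :
  (n < k)%nat -> ('X^k * A)%fps n = 0.
Proof.
revert n; induction k as [|k IH]; intros n Hn; [lia|].
destruct n as [|n].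
- rewrite fps_mul_0. unfold fps_monomial; simpl. ring.
- rewrite fps_mul_S. change (fps_tail 'X^(S k)%fps) with (fps_monomial k).
  rewrite IH by lia. unfold fps_monomial; simpl. ring.
Qed.

Lemma fps_monomial_mul_add (k : nat) (A : fps) (n : nat) :
  ('X^k * A)%fps (k + n)%nat = A n.
Proof.
induction k as [|k IH].
- change (fps_monomial 0) with fps_one. now rewrite fps_mul_1_l.
- change (S k + n)%nat with (S (k + n)). rewrite fps_mul_S. change (fps_tail 'X^(S k)%fps) with (fps_monomial k).
  rewrite IH. unfold fps_monomial; simpl. ring.
Qed.

Lemma fps_monomial_factor (k : nat) (A : fps) :
  (forall n, (n < k)%nat -> A n = 0) -> A = ('X^k * fun n => A (k + n)%nat)%fps.
Proof.
intros HA. apply functional_extensionality; intro n.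
destruct (Nat.lt_ge_cases n k) as [Hn|Hn].
- rewrite fps_monomial_mul_lt by assumption. now apply HA.
- replace n with (k + (n - k))%nat by lia. now rewrite fps_monomial_mul_add.
Qed.

Lemma fps_monomial_inj (k : nat) (A B : fps) :
  ('X^k * A)%fps = ('X^k * B)%fps -> A = B.
Proof.
intros H. apply functional_extensionality; intro n.
apply (f_equal (fun F => F (k + n)%nat)) in H. now rewrite !fps_monomial_mul_add in H.
Qed.

Lemma fps_monomial_add (j k : nat) : fps_monomial (j + k) = ('X^j * 'X^k)%fps.
Proof.
apply functional_extensionality; intro n.
destruct (Nat.lt_ge_cases n j) as [Hn|Hn].
- rewrite fps_monomial_mul_lt by assumption. unfold fps_monomial.
  now rewrite (proj2 (Nat.eqb_neq _ _)) by lia.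
- replace n with (j + (n - j))%nat by lia. rewrite fps_monomial_mul_add.
  unfold fps_monomial.
  destruct (Nat.eqb_spec (j + (n - j)) (j + k)); destruct (Nat.eqb_spec (n - j) k);
    trivial; lia.
Qed.

Lemma fps_mul_inv_r (A : fps) : A 0%nat <> 0 -> (A * fps_inv A)%fps = 1%fps.
Proof.
intros HA. apply functional_extensionality; intro n. now apply fps_mul_inv.
Qed.

(** * Continued fractions from recurrences *)

Lemma cf_denominator_0 (a : nat -> C) (N i : nat) : cf_denominator a N i 0%nat = 1.
Proof.
destruct N as [|N]; [reflexivity|]. simpl. unfold fps_add, fps_div.
rewrite fps_mul_0. unfold fps_scal, fps_one, fps_monomial; simpl. ring.
Qed.

Lemma cf_denominator_S (a : nat -> C) (N i : nat) :
  cf_denominator a (S N) i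
  = (1 + fps_const (a i) * 'X^3 * fps_inv (cf_denominator a N (S i)))%fps.
Proof. simpl. unfold fps_div. now rewrite (fps_const_mul (a i)). Qed.

(* [H i / H (i+1)] is the continued fraction [1 + a_{i+1} x^3 / (1 + ...)], and
   truncating it after [N] steps costs a relative error of order [x^(3N+3)]. *)
Lemma cf_denominator_approx (a : nat -> C) (H : nat -> fps) :
  (forall i, H i = (H (S i) + fps_const (a (S i)) * 'X^3 * H (S (S i)))%fps) ->
  forall N i, exists R : fps,
    (cf_denominator a N (S i) * H (S i))%fps = (H i + 'X^(3 * S N) * R)%fps.
Proof.
intros Hrec N; induction N as [|N IH]; intros i.
(* The empty truncation is 1, and [H (S i)] misses [H i] by one term of the recurrence. *)
- exists (- (fps_const (a (S i)) * H (S (S i))))%fps.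
  rewrite (Hrec i). change (cf_denominator a 0 (S i)) with fps_one.
  change (3 * 1)%nat with 3%nat. ring.
- destruct (IH (S i)) as [R HR].
  rewrite cf_denominator_S.
  set (D := cf_denominator a N (S (S i))) in *.
  assert (HD : (D * fps_inv D)%fps = 1%fps).
  { apply fps_mul_inv_r. unfold D. rewrite cf_denominator_0.
    exact C1_nz. }
  (* The error of the inner truncation is divided by [D] and multiplied by [a (S i) * x^3], which
     gains three degrees. *)
  exists (- (fps_const (a (S i)) * fps_inv D * R))%fps.
  replace (3 * S (S N))%nat with (3 + 3 * S N)%nat by lia.
  rewrite fps_monomial_add.
  assert (HH : H (S i) = (D * H (S (S i)) - 'X^(3 * S N) * R)%fps)
    by (rewrite HR; ring).
  transitivity (H (S i) + fps_const (a (S i)) * 'X^3 * fps_inv D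
                 * (D * H (S (S i)) - 'X^(3 * S N) * R))%fps.
  + rewrite <- HH. ring.
  + transitivity (H (S i) + fps_const (a (S i)) * 'X^3 * ((D * fps_inv D) * H (S (S i)))
                 - fps_const (a (S i)) * 'X^3 * fps_inv D * ('X^(3 * S N) * R))%fps;
      [ring|].
    rewrite HD, (Hrec i). ring.
Qed.

(** The denominators approximate [H 0 / H 1], so the normalisation [H 0 = 1] makes [H 1] the inverse
    of the infinite fraction [1 + a_1 x^3 / (1 + ...)]. *)
Lemma is_continued_fraction_of_recurrence (k : nat) (a : nat -> C) (H : nat -> fps) :
  H 0%nat = 1%fps ->
  (forall i, H i = (H (S i) + fps_const (a (S i)) * 'X^3 * H (S (S i)))%fps) ->
  is_continued_fraction k a ('X^k * H 1%nat)%fps.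
Proof.
(* Convergent number [N] is exact below degree [3 * S N], which exceeds [n] as soon as [n <= N]. *)
intros H0 Hrec n. exists n. intros N HN.
destruct (cf_denominator_approx a H Hrec N 0) as [R HR].
unfold cf_convergent, fps_div. set (D := cf_denominator a N 1) in *.
assert (HD : (D * fps_inv D)%fps = 1%fps).
{ apply fps_mul_inv_r. unfold D. rewrite cf_denominator_0. exact C1_nz. }
assert (E : ('X^k * H 1%nat)%fps
            = ('X^k * fps_inv D + 'X^(3 * S N) * ('X^k * fps_inv D * R))%fps).
{ transitivity ('X^k * fps_inv D * (D * H 1%nat))%fps.
  - transitivity ('X^k * ((D * fps_inv D) * H 1%nat))%fps; [rewrite HD|]; ring.
  - rewrite HR, H0. ring. }
rewrite E. unfold fps_add at 1. rewrite (fps_monomial_mul_lt (3 * S N)) by lia. ring.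
Qed.

(* The hypotheses say that [G 0] is the J-fraction obtained by contracting two
   consecutive levels of the S-fraction with coefficients [a]; the sequence [H] below
   undoes the contraction. *)
Lemma is_continued_fraction_of_contraction (k : nat) (a : nat -> C) (G : nat -> fps) :
  (G 0%nat + fps_const (a 1%nat) * 'X^3 * G 0%nat
     - fps_const (a 1%nat * a 2%nat) * 'X^3 * 'X^3 * G 1%nat)%fps = 1%fps ->
  (forall r, G (S r) = (G r - fps_const (a (2 * r + 2)%nat + a (2 * r + 3)%nat) * 'X^3 * G (S r)
     + fps_const (a (2 * r + 3)%nat * a (2 * r + 4)%nat) * 'X^3 * 'X^3 * G (S (S r)))%fps) ->
  is_continued_fraction k a ('X^k * G 0%nat)%fps.
Proof.
intros HG0 HG.
(* Once [H (2 r + 1)] is [G r], the recurrence at the index [2 r + 1] leaves no other choice for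
   [H (2 r + 2)]. The recurrence at even indices is then the hypothesis on [G]. *)
set (even_term := fun r => (G r - fps_const (a (2 * r + 2)%nat) * 'X^3 * G (S r))%fps).
set (H := fun i => match i with
  | O => 1%fps
  | S j => if Nat.even j then G (Nat.div2 j) else even_term (Nat.div2 j)
  end).
change (G 0%nat) with (H 1%nat).
apply (is_continued_fraction_of_recurrence k a H); [reflexivity|].
assert (Hodd : forall r, H (S (2 * r)) = G r).
{ intros r. unfold H. rewrite Nat.even_even, Nat.div2_double. reflexivity. }
assert (Heven : forall r, H (S (S (2 * r))) = even_term r).
{ intros r. unfold H. rewrite Nat.even_succ, <- Nat.negb_even, Nat.even_even.
  simpl negb. now rewrite Nat.div2_succ_double. }
intros i. destruct i as [|j].
- change (1%fps = (G 0%nat + fps_const (a 1%nat) * 'X^3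
           * (G 0%nat - fps_const (a 2%nat) * 'X^3 * G 1%nat))%fps).
  rewrite <- HG0,  fps_const_mult. ring.
- destruct (Nat.Even_or_Odd j) as [[r ->]|[r ->]].
  + rewrite Hodd, Heven. replace (S (S (S (2 * r)))) with (S (2 * (S r))) by lia.
    rewrite Hodd. unfold even_term. replace (S (S (2 * r))) with (2 * r + 2)%nat by lia.
    ring.
  + replace (2 * r + 1)%nat with (S (2 * r)) by lia. rewrite Heven.
    replace (S (S (S (2 * r)))) with (S (2 * S r)) by lia. rewrite Hodd.
    rewrite Heven.
    assert (E : G r = (G (S r)
        + fps_const (a (2 * r + 2)%nat + a (2 * r + 3)%nat) * 'X^3 * G (S r)
        - fps_const (a (2 * r + 3)%nat * a (2 * r + 4)%nat) * 'X^3 * 'X^3 * G (S (S r)))%fps)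
      by (rewrite (HG r) at 1; ring).
    unfold even_term. rewrite E.
    replace (S (2 * S r)) with (2 * r + 3)%nat by lia.
    replace (2 * S r + 2)%nat with (2 * r + 4)%nat by lia.
    rewrite fps_const_mult, fps_const_add. ring.
Qed.

(** * Derivation and Laplace transform *)

Definition Cnat (n : nat) : C := RtoC (INR n).

Lemma Cnat_S (n : nat) : Cnat (S n) = Cnat n + 1.
Proof. unfold Cnat. now rewrite S_INR, RtoC_plus. Qed.

Lemma Cnat_mult (m n : nat) : Cnat (m * n) = Cnat m * Cnat n.
Proof. unfold Cnat. now rewrite mult_INR, RtoC_mult. Qed.

Lemma Cnat_add (m n : nat) : Cnat (m + n) = Cnat m + Cnat n.
Proof. unfold Cnat. now rewrite plus_INR, RtoC_plus. Qed.

Lemma Cnat_neq_0 (n : nat) : n <> 0%nat -> Cnat n <> 0.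
Proof.
intros Hn H. apply Hn, INR_eq. now apply RtoC_inj in H.
Qed.

Definition fps_nat (n : nat) : fps := fps_const (Cnat n).

Lemma fps_nat_S (n : nat) : fps_nat (S n) = (fps_nat n + 1)%fps.
Proof. unfold fps_nat. now rewrite Cnat_S, fps_const_add, fps_const_1. Qed.

Lemma fps_nat_add (m n : nat) : fps_nat (m + n) = (fps_nat m + fps_nat n)%fps.
Proof. unfold fps_nat. now rewrite Cnat_add, fps_const_add. Qed.

Lemma fps_nat_mult (m n : nat) : fps_nat (m * n) = (fps_nat m * fps_nat n)%fps.
Proof. unfold fps_nat. now rewrite Cnat_mult, fps_const_mult. Qed.

Lemma fps_nat_0 : fps_nat 0 = 0%fps.
Proof.
apply functional_extensionality; intro n.
unfold fps_nat, fps_const, fps_scal, Cnat, fps_zero. simpl. ring.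
Qed.

Definition fps_deriv (A : fps) : fps := fun n => Cnat (S n) * A (S n).

Lemma fps_deriv_add (A B : fps) : fps_deriv (A + B)%fps = (fps_deriv A + fps_deriv B)%fps.
Proof. apply functional_extensionality; intro n. unfold fps_deriv, fps_add. ring. Qed.

Lemma fps_deriv_opp (A : fps) : fps_deriv (- A)%fps = (- fps_deriv A)%fps.
Proof. apply functional_extensionality; intro n. unfold fps_deriv, fps_opp. ring. Qed.

(** The extra term is the gap between the factors [n + 2] and [n + 1]; it supplies the missing copy
    in the induction for the product rule. *)
Lemma fps_tail_deriv (A : fps) :
  fps_tail (fps_deriv A) = (fps_deriv (fps_tail A) + fps_tail (fps_tail A))%fps.
Proof.
apply functional_extensionality; intro n.
unfold fps_tail, fps_deriv, fps_add. rewrite (Cnat_S (S n)). ring.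
Qed.

Lemma fps_deriv_mul (A B : fps) :
  fps_deriv (A * B)%fps = (fps_deriv A * B + A * fps_deriv B)%fps.
Proof.
apply functional_extensionality; intro n. revert A B; induction n as [|n IH]; intros A B.
- unfold fps_add. rewrite !fps_mul_0. unfold fps_deriv.
  rewrite fps_mul_S, fps_mul_0. unfold fps_tail, Cnat; simpl. ring.
- unfold fps_add. rewrite !fps_mul_S. unfold fps_deriv at 1.
  rewrite fps_mul_S, fps_tail_deriv, fps_mul_add_distr_r, Cnat_S.
  specialize (IH (fps_tail A) B). unfold fps_deriv at 1 in IH.
  unfold fps_add in *.
  transitivity (Cnat (S (S n)) * (A 0%nat * B (S (S n))) +
     (fps_tail A * B)%fps (S n) + (Cnat (S n) * (fps_tail A * B)%fps (S n))).
  + rewrite (Cnat_S (S n)). ring.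
  + rewrite IH, (fps_mul_S (fps_tail A) B). unfold fps_deriv, Cnat, fps_tail; simpl. ring.
Qed.

Lemma fps_deriv_nat (n : nat) : fps_deriv (fps_nat n) = 0%fps.
Proof.
apply functional_extensionality; intro k.
unfold fps_deriv, fps_nat, fps_const, fps_scal, fps_one, fps_monomial, fps_zero; simpl. ring.
Qed.

Lemma fps_deriv_0 : fps_deriv 0%fps = 0%fps.
Proof. rewrite <- fps_nat_0 at 1. apply fps_deriv_nat. Qed.

Lemma fps_deriv_1 : fps_deriv 1%fps = 0%fps.
Proof. rewrite <- fps_const_1. exact (fps_deriv_nat 1). Qed.

Lemma fps_deriv_eq_0 (A : fps) : fps_deriv A = 0%fps -> A = fps_const (A 0%nat).
Proof.
intros H. apply functional_extensionality; intro n.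
unfold fps_const, fps_scal, fps_one, fps_monomial. destruct n as [|n]; simpl; [ring|].
apply (f_equal (fun F => / Cnat (S n) * F n)) in H. unfold fps_deriv, fps_zero in H.
rewrite Cmult_assoc, Cinv_l in H by (apply Cnat_neq_0; lia).
transitivity (1 * A (S n)); [ring|]. rewrite H. ring.
Qed.

Fixpoint fps_pow (A : fps) (n : nat) : fps :=
  match n with O => 1%fps | S m => (A * fps_pow A m)%fps end.

(** Yields both the order of vanishing of the powers of [s] and their leading coefficients. *)
Lemma fps_pow_factor (A : fps) (n : nat) : A 0%nat = 0 ->
  fps_pow A n = ('X^n * fps_pow (fps_tail A) n)%fps.
Proof.
intros HA. induction n as [|n IH].
- change (fps_monomial 0) with fps_one. simpl. ring.
- cbn [fps_pow]. rewrite IH.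
  rewrite (fps_monomial_factor 1 A) at 1 by (intros j Hj; now replace j with 0%nat by lia).
  change (fun m => A (1 + m)%nat) with (fps_tail A).
  change (S n) with (1 + n)%nat. rewrite fps_monomial_add. ring.
Qed.

Lemma fps_pow_0 (A : fps) (n : nat) : A 0%nat = 1 -> fps_pow A n 0%nat = 1.
Proof.
intros HA. induction n as [|n IH]; [reflexivity|].
cbn [fps_pow]. rewrite fps_mul_0, HA, IH. ring.
Qed.

(* Passes from the coefficients of [u^n] to those of [u^n / n!]. *)
Definition fps_borel_inv (A : fps) : fps := fun n => Cnat (fact n) * A n.

(** On the coefficients of [u^n / n!] derivation is a pure shift; this is how a differential
    equation becomes a recurrence in powers of [x]. *)
Lemma fps_borel_inv_deriv (A : fps) : fps_borel_inv (fps_deriv A) = fps_tail (fps_borel_inv A).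
Proof.
apply functional_extensionality; intro n.
unfold fps_borel_inv, fps_deriv, fps_tail. change (fact (S n)) with (S n * fact n)%nat.
rewrite Cnat_mult. ring.
Qed.

Lemma fps_borel_inv_add (A B : fps) :
  fps_borel_inv (A + B)%fps = (fps_borel_inv A + fps_borel_inv B)%fps.
Proof. apply functional_extensionality; intro n. unfold fps_borel_inv, fps_add. ring. Qed.

Lemma fps_borel_inv_const_mul (z : C) (A : fps) :
  fps_borel_inv (fps_const z * A)%fps = (fps_const z * fps_borel_inv A)%fps.
Proof.
rewrite !fps_const_mul. apply functional_extensionality; intro n.
unfold fps_borel_inv, fps_scal. ring.
Qed.

Lemma formal_laplace_mul (c : fps) : formal_laplace c = ('X^1 * c)%fps.
Proof.
apply functional_extensionality; intros [|n].
- now rewrite fps_monomial_mul_lt by lia.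
- symmetry. exact (fps_monomial_mul_add 1 c n).
Qed.

(* [f r] starts at degree [3 r + e], and the third derivative acts on the [f r] as a Jacobi
   matrix; the Laplace transform turns [d/du] into multiplication by [1/x], so that the
   Jacobi matrix becomes a three-term recurrence in [x^3]. *)
Lemma is_continued_fraction_of_jacobi (a t : nat -> C) (f : nat -> fps) (e : nat) :
  (e < 2)%nat ->
  (forall r n, (n < 3 * r + e)%nat -> f r n = 0) ->
  (forall r, f r (3 * r + e)%nat = 1) ->
  (forall n, (n < 3)%nat -> n <> e -> f 0%nat n = 0) ->
  fps_deriv (fps_deriv (fps_deriv (f 0%nat)))
    = (fps_const (t 0%nat) * f 1%nat - fps_const (a 1%nat) * f 0%nat)%fps ->
  (forall r, fps_deriv (fps_deriv (fps_deriv (f (S r))))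
    = (fps_nat ((3 * r + e + 3) * (3 * r + e + 2) * (3 * r + e + 1)) * f r
       - fps_const (a (2 * r + 2)%nat + a (2 * r + 3)%nat) * f (S r)
       + fps_const (t (S r)) * f (S (S r)))%fps) ->
  (forall r, t r * Cnat ((3 * r + e + 3) * (3 * r + e + 2) * (3 * r + e + 1))
     = a (2 * r + 1)%nat * a (2 * r + 2)%nat) ->
  is_continued_fraction (S e) a (formal_laplace (fps_borel_inv (f 0%nat))).
Proof.
intros He Hord Hlead Hf0 HD0 HD Ht.
set (p := fun r => Cnat ((3 * r + e + 3) * (3 * r + e + 2) * (3 * r + e + 1))) in *.
set (w := fun r => Cnat (fact (3 * r + e))).
set (L := fun r => fps_borel_inv (f r)).
(* [w r] is the leading coefficient of [L r], so [G r] is [L r] without its leading monomial. The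
   ratio [w (S r) / w r = p r] cancels the coefficient of [f r] in the third derivative of [f (S r)]
   and turns [t r] into [t r * p r], the product of two numerators. *)
set (G := fun r n => / w r * L r (3 * r + e + n)%nat).
assert (Hw : forall r, w r <> 0) by (intros r; apply Cnat_neq_0, fact_neq_0).
(* Here [e < 2] enters: [0! = 1! = 1], so the first series carries no scalar. *)
assert (Hw0 : w 0%nat = 1).
{ unfold w. destruct e as [|[|e]]; [reflexivity..|lia]. }
assert (Hw_S : forall r, w (S r) = p r * w r).
{ intros r. unfold w, p. rewrite <- Cnat_mult. f_equal.
  replace (3 * S r + e)%nat with (S (S (S (3 * r + e)))) by lia.
  set (m := (3 * r + e)%nat). rewrite !(Nat.add_comm m).
  change (fact (S (S (S m))))
    with ((3 + m) * ((2 + m) * ((1 + m) * fact m)))%nat. ring. }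
assert (HL : forall r, L r = (fps_const (w r) * ('X^(3 * r + e) * G r))%fps).
{ intros r.
  rewrite (fps_monomial_factor (3 * r + e) (L r)).
  - transitivity ('X^(3 * r + e) * (fps_const (w r) * G r))%fps; [|ring].
    f_equal. rewrite fps_const_mul. apply functional_extensionality; intro n.
    unfold fps_scal, G. now rewrite Cmult_assoc, Cinv_r, Cmult_1_l.
  - intros n Hn. unfold L, fps_borel_inv. rewrite (Hord r n Hn). ring. }
assert (HLD : forall r, (fun n => L r (3 + n)%nat)
                = fps_borel_inv (fps_deriv (fps_deriv (fps_deriv (f r))))).
{ intros r. now rewrite !fps_borel_inv_deriv. }
assert (Hsub : forall A B : fps, fps_borel_inv (A - B)%fps = (fps_borel_inv A - fps_borel_inv B)%fps).
{ intros A B. apply functional_extensionality; intro n.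
  unfold fps_borel_inv, fps_sub, fps_add, fps_opp. ring. }
rewrite formal_laplace_mul. fold (L 0%nat). rewrite HL, Hw0, fps_const_1.
replace ('X^1 * (1 * ('X^(3 * 0 + e) * G 0%nat)))%fps with ('X^(S e) * G 0%nat)%fps
  by (change (S e) with (1 + (3 * 0 + e))%nat; rewrite (fps_monomial_add 1); ring).
apply is_continued_fraction_of_contraction.
(* Below degree 3 only degree [e] contributes. This initial term, divided by [x^e], is the 1 on the
   right of the first contraction equation. *)
- assert (E : L 0%nat = ('X^e + 'X^3 * (fun n => L 0%nat (3 + n)%nat))%fps).
  { transitivity ('X^e + (L 0%nat - 'X^e))%fps; [ring|]. f_equal.
    rewrite (fps_monomial_factor 3 (L 0%nat - 'X^e)%fps).
    - f_equal. apply functional_extensionality; intro n.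
      unfold fps_sub, fps_add, fps_opp, fps_monomial at 1.
      rewrite (proj2 (Nat.eqb_neq (3 + n) e)) by lia. ring.
    - intros n Hn. unfold fps_sub, fps_add, fps_opp, fps_monomial.
      destruct (Nat.eqb_spec n e) as [->|Hne].
      + unfold L, fps_borel_inv. rewrite (Hlead 0%nat : f 0%nat e = 1).
        change (Cnat (fact e)) with (w 0%nat). rewrite Hw0. ring.
      + unfold L, fps_borel_inv. rewrite Hf0 by assumption. ring. }
  rewrite HLD, HD0, Hsub, !fps_borel_inv_const_mul in E.
  fold (L 0%nat) in E. fold (L 1%nat) in E. rewrite !HL, Hw0, fps_const_1 in E.
  rewrite Hw_S, Hw0 in E.
  replace (3 * 1 + e)%nat with (3 + (3 * 0 + e))%nat in E by lia.
  rewrite (fps_monomial_add 3) in E. change (3 * 0 + e)%nat with e in E.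
  apply (fps_monomial_inj e).
  rewrite <- (Ht 0%nat : _ = a 1%nat * a 2%nat). fold (p 0%nat).
  rewrite !fps_const_mult, fps_const_1 in *.
  transitivity ((1 * ('X^e * G 0%nat)) + 'X^3 * (fps_const (a 1%nat) * (1 * ('X^e * G 0%nat)))
     - 'X^3 * (fps_const (t 0%nat) * (fps_const (p 0%nat) * 1 * ('X^3 * 'X^e * G 1%nat))))%fps;
    [ring|].
  rewrite E at 1. ring.
- intros r.
  (* From the second member on the order is at least 3, so no initial values appear. *)
  assert (E : L (S r) = ('X^3 * (fun n => L (S r) (3 + n)%nat))%fps).
  { apply fps_monomial_factor. intros n Hn. unfold L, fps_borel_inv.
    rewrite Hord by lia. ring. }
  rewrite HLD, HD, fps_borel_inv_add, Hsub in E. unfold fps_nat in E.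
  rewrite !fps_borel_inv_const_mul in E.
  fold (L r) in E. fold (L (S r)) in E. fold (L (S (S r))) in E. fold (p r) in E.
  rewrite !HL in E. rewrite (Hw_S (S r)) in E.
  replace (3 * S (S r) + e)%nat with (3 + (3 * S r + e))%nat in E by lia.
  rewrite (fps_monomial_add 3) in E.
  assert (Em : fps_monomial (3 * S r + e) = ('X^3 * 'X^(3 * r + e))%fps).
  { rewrite <- fps_monomial_add. f_equal. lia. }
  assert (Ep : fps_const (w (S r)) = (fps_const (p r) * fps_const (w r))%fps)
    by now rewrite Hw_S, fps_const_mult.
  apply (fps_monomial_inj (3 * S r + e)), (fps_const_inj _ _ _ (Hw (S r))).
  rewrite E. replace (2 * r + 3)%nat with (2 * S r + 1)%nat by lia.
  replace (2 * r + 4)%nat with (2 * S r + 2)%nat by lia.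
  rewrite <- (Ht (S r)). fold (p (S r)). rewrite !fps_const_mult.
  replace ('X^3 * (fps_const (p r) * (fps_const (w r) * ('X^(3 * r + e) * G r))))%fps
    with (fps_const (w (S r)) * ('X^(3 * S r + e) * G r))%fps
    by (rewrite Em, Ep; ring).
  transitivity (('X^3 * 'X^(3 * r + e)) * (fps_const (p r) * fps_const (w r)) * G r
     - 'X^3 * (fps_const (a (2 * r + 2)%nat + a (2 * S r + 1)%nat) *
         (fps_const (w (S r)) * ('X^(3 * S r + e) * G (S r))))
     + 'X^3 * (fps_const (t (S r)) *
         (fps_const (p (S r)) * fps_const (w (S r)) * ('X^3 * 'X^(3 * S r + e) * G (S (S r))))))%fps.
  + ring.
  + rewrite <- Em, <- Ep. ring.
Qed.

(** * The formal series of sm and cm *)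

Lemma fps_deriv_pow (A : fps) (n : nat) :
  fps_deriv (fps_pow A (S n)) = (fps_nat (S n) * (fps_pow A n * fps_deriv A))%fps.
Proof.
induction n as [|n IH].
- cbn [fps_pow]. rewrite fps_nat_S, fps_nat_0.
  replace (A * 1)%fps with A by ring. ring.
- change (fps_pow A (S (S n))) with (A * fps_pow A (S n))%fps.
  rewrite fps_deriv_mul, IH, (fps_nat_S (S n)). cbn [fps_pow]. ring.
Qed.

Definition is_formal_sm_cm (s c : fps) : Prop :=
  fps_deriv s = (c * c)%fps /\ fps_deriv c = (- (s * s))%fps /\ s 0%nat = 0 /\ c 0%nat = 1.

(** [s^3 + c^3] has derivative [3 s^2 c^2 - 3 c^2 s^2 = 0]. The relation is solved for [c^3] so that
    [ring] can use it as a rule eliminating [c]. *)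
Lemma formal_fermat (s c : fps) : is_formal_sm_cm s c ->
  (c * c * c)%fps = (1 - s * s * s)%fps.
Proof.
intros (Ds & Dc & s0 & c0).
assert (E : (s * s * s + c * c * c)%fps = 1%fps).
{ rewrite fps_deriv_eq_0 with (A := (s * s * s + c * c * c)%fps).
  - replace ((s * s * s + c * c * c)%fps 0%nat) with (RtoC 1); [apply fps_const_1|].
    unfold fps_add. rewrite !fps_mul_0, s0, c0. ring.
  - rewrite fps_deriv_add, !fps_deriv_mul, Ds, Dc. ring. }
rewrite <- E. ring.
Qed.

(** For [n = m + 3] the second derivative of [s^n] reduces to
    [n (n-1) s^(n-2) c - n (n+1) s^(n+1) c]; one more derivation and the cubic relation give the
    three terms. Writing the exponent as [m + 3] avoids subtraction, and the middle coefficient is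
    left as a sum of two numerators. *)
Lemma fps_deriv3_pow_sm (s c : fps) (m : nat) : is_formal_sm_cm s c ->
  fps_deriv (fps_deriv (fps_deriv (fps_pow s (m + 3))))
  = (fps_nat ((m + 3) * (m + 2) * (m + 1)) * fps_pow s m
     - fps_nat ((m + 3) * (m + 2) ^ 2 + (m + 3) * (m + 4) ^ 2) * fps_pow s (m + 3)
     + fps_nat ((m + 3) * (m + 4) * (m + 5)) * fps_pow s (m + 6))%fps.
Proof.
intros H. pose proof (formal_fermat s c H) as HF. destruct H as (Ds & Dc & s0 & c0).
rewrite (Nat.add_comm m 3), (Nat.add_comm m 6).
change (3 + m)%nat with (S (S (S m))). change (6 + m)%nat with (S (S (S (S (S (S m)))))).
repeat (rewrite ?fps_deriv_add, ?fps_deriv_nat, ?fps_deriv_0, ?fps_deriv_mul, ?fps_deriv_opp,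
         ?fps_deriv_pow, ?Ds, ?Dc).
cbn [Nat.pow].
repeat rewrite ?fps_nat_add, ?fps_nat_mult, ?fps_nat_S, ?fps_nat_0. cbn [fps_pow].
ring [HF].
Qed.

(** For [n = m + 3] the first derivative reduces to [n s^(n-1) - (n+1) s^(n+2)], free of [c]; two
    more derivations bring back one factor [c]. *)
Lemma fps_deriv3_pow_sm_mul_cm (s c : fps) (m : nat) : is_formal_sm_cm s c ->
  fps_deriv (fps_deriv (fps_deriv (fps_pow s (m + 3) * c)%fps))
  = (fps_nat ((m + 3) * (m + 2) * (m + 1)) * (fps_pow s m * c)
     - fps_nat ((m + 2) * (m + 3) ^ 2 + (m + 4) ^ 2 * (m + 5)) * (fps_pow s (m + 3) * c)
     + fps_nat ((m + 4) * (m + 5) * (m + 6)) * (fps_pow s (m + 6) * c))%fps.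
Proof.
intros H. pose proof (formal_fermat s c H) as HF. destruct H as (Ds & Dc & s0 & c0).
rewrite (Nat.add_comm m 3), (Nat.add_comm m 6).
change (3 + m)%nat with (S (S (S m))). change (6 + m)%nat with (S (S (S (S (S (S m)))))).
repeat (rewrite ?fps_deriv_add, ?fps_deriv_nat, ?fps_deriv_0, ?fps_deriv_mul, ?fps_deriv_opp,
         ?fps_deriv_pow, ?Ds, ?Dc).
cbn [Nat.pow].
repeat rewrite ?fps_nat_add, ?fps_nat_mult, ?fps_nat_S, ?fps_nat_0. cbn [fps_pow].
ring [HF].
Qed.

(** The free factor [A] serves all families: it is 1 for the pure powers and [c] for the others. *)
Lemma fps_pow_sm_lt (s c : fps) (n k : nat) (A : fps) : is_formal_sm_cm s c ->
  (k < n)%nat -> (fps_pow s n * A)%fps k = 0.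
Proof.
intros (_ & _ & s0 & _) Hk. rewrite fps_pow_factor by exact s0.
replace ('X^n * fps_pow (fps_tail s) n * A)%fps
  with ('X^n * (fps_pow (fps_tail s) n * A))%fps by ring.
now apply fps_monomial_mul_lt.
Qed.

Lemma fps_pow_sm_lead (s c : fps) (n : nat) (A : fps) : is_formal_sm_cm s c ->
  A 0%nat = 1 -> (fps_pow s n * A)%fps n = 1.
Proof.
intros (Ds & _ & s0 & c0) HA. rewrite fps_pow_factor by exact s0.
replace ('X^n * fps_pow (fps_tail s) n * A)%fps
  with ('X^n * (fps_pow (fps_tail s) n * A))%fps by ring.
rewrite <- (Nat.add_0_r n) at 3. rewrite fps_monomial_mul_add, fps_mul_0, HA, fps_pow_0; [ring|].
apply (f_equal (fun F => F 0%nat)) in Ds. rewrite fps_mul_0, c0 in Ds.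
unfold fps_deriv, Cnat in Ds. simpl in Ds. unfold fps_tail.
rewrite <- (Cmult_1_l (s 1%nat)), Ds. ring.
Qed.

Lemma formal_sm_cm_low_coeffs (s c : fps) : is_formal_sm_cm s c ->
  s 1%nat = 1 /\ s 2%nat = 0 /\ c 1%nat = 0 /\ c 2%nat = 0.
Proof.
intros (Ds & Dc & s0 & c0).
assert (E : forall (A : fps) n, A (S n) = / Cnat (S n) * fps_deriv A n).
{ intros A n. unfold fps_deriv. rewrite Cmult_assoc, Cinv_l, Cmult_1_l; [reflexivity|].
  now apply Cnat_neq_0. }
assert (c1 : c 1%nat = 0).
{ rewrite E, Dc. unfold fps_opp. rewrite fps_mul_0, s0. ring. }
assert (E1 : Cnat 1 = 1) by reflexivity.
repeat split; [| |exact c1|].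
- rewrite E, Ds, fps_mul_0, c0, E1. field.
- rewrite E, Ds, fps_mul_S, fps_mul_0. unfold fps_tail. rewrite c1. ring.
- rewrite E, Dc. unfold fps_opp. rewrite fps_mul_S, fps_mul_0.
  unfold fps_tail. rewrite s0. ring.
Qed.

Lemma formal_sm_continued_fraction (s c : fps) (a : nat -> C) : is_formal_sm_cm s c ->
  (forall r : nat, a (2 * r + 1)%nat = Cnat ((3 * r + 1) * (3 * r + 2) ^ 2)) ->
  (forall r : nat, a (2 * r + 2)%nat = Cnat ((3 * r + 3) ^ 2 * (3 * r + 4))) ->
  is_continued_fraction 2 a (formal_laplace (fps_borel_inv s)).
Proof.
intros H Hodd Heven. pose proof (formal_fermat s c H) as HF.
pose proof H as (Ds & Dc & s0 & c0).
set (f := fun r => (fps_pow s (3 * r + 1) * 1)%fps).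
set (t := fun r => Cnat ((3 * r + 1) * (3 * r + 2) * (3 * r + 3))).
replace s with (f 0%nat) by (unfold f; simpl; ring).
apply (is_continued_fraction_of_jacobi a t f 1); unfold f, t.
- lia.
- intros r n Hn. now apply (fps_pow_sm_lt s c).
- intros r. now apply (fps_pow_sm_lead s c).
- intros n Hn Hne. replace (fps_pow s (3 * 0 + 1) * 1)%fps with s by (simpl; ring).
  destruct n as [|[|[|n]]]; [exact s0|lia| |lia].
  apply (formal_sm_cm_low_coeffs s c H).
(* The exponent 1 is too small for the general formula; directly, [s''' = 6 s^4 - 4 s]. *)
- rewrite (Hodd 0%nat : a 1%nat = _).
  fold (fps_nat ((3 * 0 + 1) * (3 * 0 + 2) ^ 2)).
  fold (fps_nat ((3 * 0 + 1) * (3 * 0 + 2) * (3 * 0 + 3))).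
  change (3 * 0 + 1)%nat with 1%nat.
  change (3 * 1 + 1)%nat with 4%nat. cbn -[fps_nat fps_deriv].
  repeat (rewrite ?fps_deriv_add, ?fps_deriv_mul, ?fps_deriv_opp, ?Ds, ?Dc,
    ?fps_deriv_1, ?fps_deriv_0).
  rewrite ?fps_nat_S, fps_nat_0. ring [HF].
- intros r. rewrite Heven. replace (2 * r + 3)%nat with (2 * S r + 1)%nat by lia.
  rewrite Hodd, <- Cnat_add.
  replace (3 * S r + 1)%nat with (3 * r + 1 + 3)%nat by lia.
  replace (3 * S (S r) + 1)%nat with (3 * r + 1 + 6)%nat by lia.
  rewrite !(fps_mul_comm _ 1), !fps_mul_1_l.
  rewrite (fps_deriv3_pow_sm s c (3 * r + 1) H).
  unfold fps_nat.
  repeat (first [reflexivity | solve [cbn [Nat.pow]; ring] | f_equal]).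
- intros r. rewrite Hodd, Heven, <- !Cnat_mult. f_equal. simpl Nat.pow. ring.
Qed.

(** [e = 0] is the case of cm and [e = 1] that of sm cm: in terms of [n = 3 r + e] their numerators
    obey the same law. *)
Lemma formal_sm_cm_continued_fraction (s c : fps) (a : nat -> C) (e : nat) :
  is_formal_sm_cm s c -> (e < 2)%nat ->
  (forall r : nat, a (2 * r + 1)%nat = Cnat ((3 * r + e + 1) ^ 2 * (3 * r + e + 2))) ->
  (forall r : nat, a (2 * r + 2)%nat = Cnat ((3 * r + e + 2) * (3 * r + e + 3) ^ 2)) ->
  is_continued_fraction (S e) a (formal_laplace (fps_borel_inv (fps_pow s e * c)%fps)).
Proof.
intros H He Hodd Heven. pose proof (formal_fermat s c H) as HF.
pose proof H as (Ds & Dc & s0 & c0).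
set (f := fun r => (fps_pow s (3 * r + e) * c)%fps).
set (t := fun r => Cnat ((3 * r + e + 1) * (3 * r + e + 2) * (3 * r + e + 3))).
change (fps_pow s e * c)%fps with (f 0%nat).
apply (is_continued_fraction_of_jacobi a t f e); unfold f, t.
- lia.
- intros r n Hn. now apply (fps_pow_sm_lt s c).
- intros r. now apply (fps_pow_sm_lead s c).
- intros n Hn Hne. destruct (formal_sm_cm_low_coeffs s c H) as (s1 & s2 & c1 & c2).
  destruct e as [|[|e]]; [| |lia]; cbn [Nat.mul Nat.add fps_pow];
    rewrite ?fps_mul_1_l, ?(fps_mul_comm s 1), ?fps_mul_1_l;
    destruct n as [|[|[|n]]]; try lia; trivial;
    rewrite ?fps_mul_S, ?fps_mul_0; unfold fps_tail; rewrite ?s0, ?s2, ?c1, ?c2; ring.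
- rewrite (Hodd 0%nat : a 1%nat = _).
  fold (fps_nat ((3 * 0 + e + 1) ^ 2 * (3 * 0 + e + 2))).
  fold (fps_nat ((3 * 0 + e + 1) * (3 * 0 + e + 2) * (3 * 0 + e + 3))).
  destruct e as [|[|e]]; [| |lia]; cbn -[fps_nat fps_deriv];
  repeat (rewrite ?fps_deriv_add, ?fps_deriv_mul, ?fps_deriv_opp, ?Ds, ?Dc,
    ?fps_deriv_1, ?fps_deriv_0);
  rewrite ?fps_nat_S, fps_nat_0; ring [HF].
- intros r. rewrite Heven. replace (2 * r + 3)%nat with (2 * S r + 1)%nat by lia.
  rewrite Hodd, <- Cnat_add.
  replace (3 * S r + e)%nat with (3 * r + e + 3)%nat by lia.
  replace (3 * S (S r) + e)%nat with (3 * r + e + 6)%nat by lia.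
  rewrite (fps_deriv3_pow_sm_mul_cm s c (3 * r + e) H).
  unfold fps_nat.
  repeat (first [reflexivity | solve [cbn [Nat.pow]; ring] | f_equal]).
- intros r. rewrite Hodd, Heven, <- !Cnat_mult. f_equal. simpl Nat.pow. ring.
Qed.

(** * Taylor expansions of complex functions *)

Lemma fst_sum_n (a : nat -> C) (n : nat) : fst (sum_n a n) = sum_n (fun k => fst (a k)) n.
Proof.
induction n as [|n IH]; [now rewrite !sum_O|]. rewrite !sum_Sn, <- IH. reflexivity.
Qed.

Lemma snd_sum_n (a : nat -> C) (n : nat) : snd (sum_n a n) = sum_n (fun k => snd (a k)) n.
Proof.
induction n as [|n IH]; [now rewrite !sum_O|]. rewrite !sum_Sn, <- IH. reflexivity.
Qed.

Definition is_series_C (a : nat -> C) (l : C) : Prop :=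
  @is_series C_AbsRing C_NormedModule a l.

Definition is_pseries_C (a : nat -> C) (u l : C) : Prop :=
  @is_pseries C_AbsRing C_NormedModule a u l.

(** Neighbourhoods in [C] are products of real ones, so convergence is tested on each component. *)
Lemma is_series_C_components (a : nat -> C) (l : C) :
  is_series_C a l <->
  is_series (fun n => fst (a n)) (fst l) /\ is_series (fun n => snd (a n)) (snd l).
Proof.
split.
- intros H; split; apply filterlim_locally; intros eps;
    generalize (proj1 (filterlim_locally _ _) H eps);
    apply filter_imp; intros n [H1 H2]; [rewrite <- fst_sum_n|rewrite <- snd_sum_n]; assumption.
- intros [H1 H2]. apply filterlim_locally; intros eps.
  generalize (filter_and _ _ (proj1 (filterlim_locally _ _) H1 eps)
                             (proj1 (filterlim_locally _ _) H2 eps)).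
  apply filter_imp. intros n [K1 K2]. split; [rewrite fst_sum_n|rewrite snd_sum_n]; assumption.
Qed.

Lemma pow_n_RtoC (t : R) (n : nat) : @pow_n C_Ring (RtoC t) n = RtoC (t ^ n).
Proof.
induction n as [|n IH]; [reflexivity|].
change (@pow_n C_Ring (RtoC t) (S n)) with (RtoC t * @pow_n C_Ring (RtoC t) n).
now rewrite IH, <- RtoC_mult.
Qed.

Lemma is_pseries_C_components (a : nat -> C) (t : R) (l : C) :
  is_pseries_C a (RtoC t) l ->
  is_pseries (fun n => fst (a n)) t (fst l) /\ is_pseries (fun n => snd (a n)) t (snd l).
Proof.
intros H. apply is_series_C_components in H. destruct H as [H1 H2].
split; [revert H1|revert H2]; apply is_series_ext; intros n; rewrite pow_n_pow.
- change (fst (@pow_n C_Ring (RtoC t) n * a n) = (t ^ n * fst (a n))%R).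
  rewrite pow_n_RtoC. simpl. ring.
- change (snd (@pow_n C_Ring (RtoC t) n * a n) = (t ^ n * snd (a n))%R).
  rewrite pow_n_RtoC. simpl. ring.
Qed.

(** Coefficients of [u^n], not of [u^n / n!], so that products of functions correspond to the
    product of [fps]. *)
Definition has_taylor (f : C -> C) (a : fps) : Prop :=
  locally (RtoC 0) (fun u : C => is_pseries_C a u (f u)).

Lemma locally_C_real (P : C -> Prop) :
  locally (RtoC 0) P -> locally 0%R (fun t => P (RtoC t)).
Proof.
intros [eps H]. exists eps. intros t Ht. apply H. split; [exact Ht|]. apply ball_center.
Qed.

Lemma CV_radius_ge (a : nat -> R) (eps : posreal) :
  (forall t : R, ball 0%R eps t -> ex_pseries a t) -> Rbar_le eps (CV_radius a).
Proof.
intros H. apply Rbar_not_lt_le. intros Hlt.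
assert (H0 := CV_radius_ge_0 a).
destruct (CV_radius a) as [r| |] eqn:Er; try easy. simpl in Hlt, H0.
(* If the radius [r] were below [eps], the series would converge at this midpoint, yet outside the
   disk its terms do not tend to 0. *)
set (t := ((r + eps) / 2)%R).
assert (Ht : Rabs t = t) by (apply Rabs_pos_eq; unfold t; destruct eps; simpl in *; lra).
apply (CV_disk_outside a t).
- rewrite Er, Ht. unfold t; simpl. lra.
- destruct (H t) as [l Hl].
  + change (Rabs (t - 0) < eps)%R. rewrite Rminus_0_r, Ht. unfold t. lra.
  + apply is_lim_seq_ext with (fun n => scal (pow_n t n) (a n)).
    * intros n. rewrite pow_n_pow. apply Rmult_comm.
    * apply (ex_series_lim_0 (fun n => scal (pow_n t n) (a n))). now exists l.
Qed.

Lemma has_taylor_radius (f : C -> C) (a : fps) : has_taylor f a ->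
  exists eps : posreal, Rbar_le eps (CV_radius (fun n => fst (a n))) /\
                        Rbar_le eps (CV_radius (fun n => snd (a n))).
Proof.
intros H. destruct (locally_C_real _ H) as [eps Heps]. exists eps.
split; apply CV_radius_ge; intros t Ht;
  destruct (is_pseries_C_components _ _ _ (Heps t Ht)) as [H1 H2]; eexists; eassumption.
Qed.

(** Convergence on the real axis bounds the radii of the real and imaginary parts from below. Both
    real series thus converge absolutely at the real point [Cmod u], and together they dominate the
    complex series at [u]. *)
Lemma has_taylor_abs (f : C -> C) (a : fps) : has_taylor f a ->
  locally (RtoC 0) (fun u : C => ex_series (fun n => Cmod (@pow_n C_Ring u n * a n))).
Proof.
intros H. destruct (has_taylor_radius f a H) as [eps [H1 H2]].
apply (locally_C (RtoC 0)). exists eps. intros u Hu.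
assert (Hmod : (Cmod u < eps)%R).
{ assert (E0 : forall z : C, z - 0 = z) by (intro; ring).
  rewrite <- (E0 u). exact Hu. }
assert (Habs : Rabs (Cmod u) = Cmod u) by apply Rabs_pos_eq, Cmod_ge_0.
assert (E1 : ex_series (fun n => Rabs (fst (a n) * Cmod u ^ n))).
{ apply CV_disk_inside. rewrite Habs. now apply (Rbar_lt_le_trans _ eps). }
assert (E2 : ex_series (fun n => Rabs (snd (a n) * Cmod u ^ n))).
{ apply (CV_disk_inside (fun n => snd (a n))). rewrite Habs. now apply (Rbar_lt_le_trans _ eps). }
assert (Hpow : forall n, Cmod (@pow_n C_Ring u n) = (Cmod u ^ n)%R).
{ induction n as [|n IH]; [exact Cmod_1|].
  change (@pow_n C_Ring u (S n)) with (u * @pow_n C_Ring u n).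
  now rewrite Cmod_mult, IH. }
refine (ex_series_le _ _ _ (ex_series_plus _ _ E1 E2)).
intros n. change (Rabs (Cmod (@pow_n C_Ring u n * a n))
  <= Rabs (fst (a n) * Cmod u ^ n) + Rabs (snd (a n) * Cmod u ^ n))%R.
rewrite Rabs_pos_eq by apply Cmod_ge_0.
rewrite Cmod_mult, Hpow, !Rabs_mult, <- Rmult_plus_distr_r, Rmult_comm.
assert (Hp : (0 <= Cmod u ^ n)%R) by (apply pow_le, Cmod_ge_0).
rewrite (Rabs_pos_eq _ Hp). apply Rmult_le_compat_r; [exact Hp|].
rewrite <- !Cmod_R.
replace (a n) with (RtoC (fst (a n)) + Ci * RtoC (snd (a n))) at 1
  by (destruct (a n); unfold RtoC, Ci, Cmult, Cplus; simpl; f_equal; ring).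
eapply Rle_trans; [apply Cmod_triangle|]. rewrite Cmod_mult.
replace (Cmod Ci) with 1%R; [lra|].
unfold Cmod, Ci; simpl. rewrite <- sqrt_1 at 1. f_equal. ring.
Qed.

Lemma ex_series_Rabs_le (a b : nat -> R) :
  (forall n, (Rabs (a n) <= b n)%R) -> ex_series b -> ex_series (fun n => Rabs (a n)).
Proof.
intros H. apply (ex_series_le (fun n => Rabs (a n)) b). intros n.
change (Rabs (Rabs (a n)) <= b n)%R. rewrite Rabs_Rabsolu. apply H.
Qed.

Lemma im_le_Cmod (z : C) : (Rabs (snd z) <= Cmod z)%R.
Proof.
unfold Cmod. rewrite <- (sqrt_Rsqr_abs (snd z)). apply sqrt_le_1_alt.
unfold Rsqr. pose proof (pow2_ge_0 (fst z)). simpl in *. lra.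
Qed.

(* Mertens' theorem for complex series, from the real one applied to the four products of
   real and imaginary parts. *)
Lemma is_series_C_mul (a b : fps) (la lb : C) :
  is_series_C a la -> is_series_C b lb ->
  ex_series (fun n => Cmod (a n)) -> ex_series (fun n => Cmod (b n)) ->
  is_series_C (a * b)%fps (la * lb).
Proof.
intros Ha Hb Aa Ab.
apply is_series_C_components in Ha, Hb. destruct Ha as [Ha1 Ha2], Hb as [Hb1 Hb2].
assert (Aa1 := ex_series_Rabs_le (fun n => fst (a n)) _ (fun n => re_le_Cmod (a n)) Aa).
assert (Aa2 := ex_series_Rabs_le (fun n => snd (a n)) _ (fun n => im_le_Cmod (a n)) Aa).
assert (Ab1 := ex_series_Rabs_le (fun n => fst (b n)) _ (fun n => re_le_Cmod (b n)) Ab).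
assert (Ab2 := ex_series_Rabs_le (fun n => snd (b n)) _ (fun n => im_le_Cmod (b n)) Ab).
apply is_series_C_components. split.
- generalize (is_series_minus _ _ _ _ (is_series_mult _ _ _ _ Ha1 Hb1 Aa1 Ab1)
    (is_series_mult _ _ _ _ Ha2 Hb2 Aa2 Ab2)).
  apply is_series_ext. intros n. unfold fps_mul. rewrite fst_sum_n, sum_n_Reals.
  symmetry. exact (minus_sum (fun k => (fst (a k) * fst (b (n - k)%nat))%R)
    (fun k => (snd (a k) * snd (b (n - k)%nat))%R) n).
- generalize (is_series_plus _ _ _ _ (is_series_mult _ _ _ _ Ha1 Hb2 Aa1 Ab2)
    (is_series_mult _ _ _ _ Ha2 Hb1 Aa2 Ab1)).
  apply is_series_ext. intros n. unfold fps_mul. rewrite snd_sum_n, sum_n_Reals.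
  symmetry. exact (plus_sum (fun k => (fst (a k) * snd (b (n - k)%nat))%R)
    (fun k => (snd (a k) * fst (b (n - k)%nat))%R) n).
Qed.

Lemma fps_mul_pow_n (u : C) (a b : fps) (n : nat) :
  ((fun k => (@pow_n C_Ring u k * a k)%C) * (fun k => (@pow_n C_Ring u k * b k)%C))%fps n
  = @pow_n C_Ring u n * (a * b)%fps n.
Proof.
unfold fps_mul. rewrite <- (sum_n_mult_l (K := C_Ring)). apply sum_n_ext_loc. intros k Hk.
replace (@pow_n C_Ring u n) with (@pow_n C_Ring u k * @pow_n C_Ring u (n - k)).
- change (@pow_n C_Ring u k * a k * (@pow_n C_Ring u (n - k) * b (n - k)%nat)
    = @pow_n C_Ring u k * @pow_n C_Ring u (n - k) * (a k * b (n - k)%nat)). ring.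
- replace n with (k + (n - k))%nat at 2 by lia. symmetry. apply (pow_n_plus (K := C_Ring)).
Qed.

Lemma has_taylor_mul (f g : C -> C) (a b : fps) :
  has_taylor f a -> has_taylor g b -> has_taylor (fun u => f u * g u) (a * b)%fps.
Proof.
intros Hf Hg.
refine (filter_imp _ _ _ (filter_and _ _ (filter_and _ _ Hf Hg)
  (filter_and _ _ (has_taylor_abs f a Hf) (has_taylor_abs g b Hg)))).
intros u [[H1 H2] [H3 H4]].
generalize (is_series_C_mul _ _ _ _ H1 H2 H3 H4). apply is_series_ext.
intros n. apply fps_mul_pow_n.
Qed.

Lemma has_taylor_ext (f g : C -> C) (a : fps) :
  (forall u, f u = g u) -> has_taylor f a -> has_taylor g a.
Proof. intros E. unfold has_taylor. apply filter_imp. intros u. now rewrite E. Qed.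

Lemma has_taylor_opp (f : C -> C) (a : fps) :
  has_taylor f a -> has_taylor (fun u => - f u) (- a)%fps.
Proof.
unfold has_taylor. apply filter_imp. intros u H. generalize (is_pseries_opp _ _ _ H).
apply is_pseries_ext. reflexivity.
Qed.

Lemma has_taylor_0 (f : C -> C) (a : fps) : has_taylor f a -> a 0%nat = f (RtoC 0).
Proof.
intros H. apply locally_singleton, is_pseries_C_components in H. destruct H as [H1 H2].
apply is_pseries_unique in H1, H2. rewrite PSeries_0 in H1, H2.
rewrite (surjective_pairing (a 0%nat)), H1, H2. symmetry. apply surjective_pairing.
Qed.

(** For a real increment, the real and imaginary parts of the complex error term are at most its
    modulus. *)
Lemma is_derive_C_real (f : C -> C) (t : R) (l : C) :
  @is_derive C_AbsRing C_NormedModule f (RtoC t) l ->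
  is_derive (fun x : R => fst (f (RtoC x))) t (fst l) /\
  is_derive (fun x : R => snd (f (RtoC x))) t (snd l).
Proof.
intros [_ H]. specialize (H (RtoC t) (fun P HP => HP)).
assert (K : forall eps : posreal, locally t (fun y : R =>
  (Cmod (f (RtoC y) - f (RtoC t) - RtoC (y - t) * l) <= eps * Rabs (y - t))%R)).
{ intros eps. destruct (H eps) as [d Hd]. exists d. intros y Hy.
  assert (E : minus (RtoC y) (RtoC t) = RtoC (y - t)) by (symmetry; apply RtoC_minus).
  assert (Hy' : (Cmod (RtoC (y - t)) < d)%R) by (rewrite Cmod_R; exact Hy).
  specialize (Hd (RtoC y)). rewrite <- (Cmod_R (y - t)), RtoC_minus.
  apply Hd. change (Cmod (minus (RtoC y) (RtoC t)) < d)%R. now rewrite E. }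
split; (split; [apply is_linear_scal_l|]); intros x Hx;
  rewrite <- (is_filter_lim_locally_unique _ _ Hx); clear x Hx; intros eps;
  generalize (K eps); apply filter_imp; intros y Hy;
  (eapply Rle_trans; [|exact Hy]);
  [eapply Rle_trans; [|apply re_le_Cmod]|eapply Rle_trans; [|apply im_le_Cmod]];
  apply Req_le; change (@norm R_AbsRing _) with Rabs; f_equal;
  unfold minus, plus, opp, scal; simpl; unfold mult; simpl; ring.
Qed.

Lemma PSeries_deriv_coeff (f g : R -> R) (a b : nat -> R) :
  Rbar_lt 0 (CV_radius a) -> Rbar_lt 0 (CV_radius b) ->
  locally 0%R (fun t => is_pseries a t (f t)) -> locally 0%R (fun t => is_pseries b t (g t)) ->
  locally 0%R (fun t => is_derive f t (g t)) -> forall n, PS_derive a n = b n.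
Proof.
intros Ra Rb Ha Hb Hd n. apply PSeries_ext_recip; [now rewrite CV_radius_derive|exact Rb|].
assert (Hr : locally 0%R (fun t => Rbar_lt (Rabs t) (CV_radius a))).
{ destruct (CV_radius a) as [r| |]; try easy.
  - exists (mkposreal r Ra). intros t Ht. change (Rabs (t - 0) < r)%R in Ht.
    now rewrite Rminus_0_r in Ht.
  - exists posreal_one. easy. }
(* Differentiating at [t] requires [f] to agree with its series on a whole neighbourhood of [t],
   hence [locally_locally]. Uniqueness of coefficients then concludes. *)
generalize (filter_and _ _ (filter_and _ _ Hr (locally_locally _ _ Ha)) (filter_and _ _ Hb Hd)).
apply filter_imp. intros t [[Hrt Hat] [Hbt Hdt]].
rewrite <- (Derive_PSeries a t Hrt), (is_pseries_unique _ _ _ Hbt).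
apply is_derive_unique. generalize Hdt. apply is_derive_ext_loc.
generalize Hat. apply filter_imp. intros x Hx. symmetry. now apply is_pseries_unique.
Qed.

Lemma has_taylor_derive (f g : C -> C) (a b : fps) :
  has_taylor f a -> has_taylor g b ->
  locally (RtoC 0) (fun u : C => @is_derive C_AbsRing C_NormedModule f u (g u)) ->
  fps_deriv a = b.
Proof.
intros Hf Hg Hd.
destruct (has_taylor_radius f a Hf) as [ea [Ra1 Ra2]].
destruct (has_taylor_radius g b Hg) as [eb [Rb1 Rb2]].
assert (pos : forall (e : posreal) (r : Rbar), Rbar_le e r -> Rbar_lt 0 r).
{ intros e r. apply Rbar_lt_le_trans. exact (cond_pos e). }
apply locally_C_real in Hf, Hg, Hd.
apply functional_extensionality; intro n.
assert (E1 : PS_derive (fun n => fst (a n)) n = fst (b n)).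
{ apply (PSeries_deriv_coeff (fun t => fst (f (RtoC t))) (fun t => fst (g (RtoC t))) _
    (fun n => fst (b n))); [now apply (pos ea)|now apply (pos eb)|..].
  - generalize Hf. apply filter_imp. intros t Ht. apply (is_pseries_C_components _ _ _ Ht).
  - generalize Hg. apply filter_imp. intros t Ht. apply (is_pseries_C_components _ _ _ Ht).
  - generalize Hd. apply filter_imp. intros t Ht. apply (is_derive_C_real _ _ _ Ht). }
assert (E2 : PS_derive (fun n => snd (a n)) n = snd (b n)).
{ apply (PSeries_deriv_coeff (fun t => snd (f (RtoC t))) (fun t => snd (g (RtoC t))) _
    (fun n => snd (b n))); [now apply (pos ea)|now apply (pos eb)|..].
  - generalize Hf. apply filter_imp. intros t Ht. apply (is_pseries_C_components _ _ _ Ht).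
  - generalize Hg. apply filter_imp. intros t Ht. apply (is_pseries_C_components _ _ _ Ht).
  - generalize Hd. apply filter_imp. intros t Ht. apply (is_derive_C_real _ _ _ Ht). }
unfold PS_derive in E1, E2. rewrite (surjective_pairing (b n)), <- E1, <- E2.
unfold fps_deriv, Cnat, Cmult, RtoC. cbn [fst snd]. f_equal; ring.
Qed.

Lemma has_expansion_borel_inv (f : C -> C) (a : fps) :
  has_taylor f a -> has_expansion f (fps_borel_inv a).
Proof.
unfold has_taylor, has_expansion. apply filter_imp. intros u. apply is_pseries_ext. intros n. unfold fps_borel_inv.
change (a n = Cnat (fact n) * a n / Cnat (fact n)). field. apply Cnat_neq_0, fact_neq_0.
Qed.

Theorem mainTheorem2
  (sm cm : C -> C)
  (sm_analytic : analytic_near_0 sm)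
  (cm_analytic : analytic_near_0 cm)
  (sm_derive : locally (RtoC 0) (fun u : C => is_derive sm u ((cm u ^ 2)%C)))
  (cm_derive : locally (RtoC 0) (fun u : C => is_derive cm u ((- (sm u ^ 2))%C)))
  (sm_0 : sm (RtoC 0) = RtoC 0)
  (cm_0 : cm (RtoC 0) = RtoC 1) :
  (forall a : nat -> C,
     (forall r : nat, (1 <= r)%nat ->
        a (2 * r - 1)%nat = RtoC (INR ((3 * r - 2) * (3 * r - 1) ^ 2)) /\
        a (2 * r)%nat = RtoC (INR ((3 * r) ^ 2 * (3 * r + 1)))) ->
     exists F : fps, is_laplace_transform sm F /\ is_continued_fraction 2 a F) /\
  (forall a : nat -> C,
     (forall r : nat, (1 <= r)%nat ->
        a (2 * r - 1)%nat = RtoC (INR ((3 * r - 2) ^ 2 * (3 * r - 1))) /\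
        a (2 * r)%nat = RtoC (INR ((3 * r - 1) * (3 * r) ^ 2))) ->
     exists F : fps, is_laplace_transform cm F /\ is_continued_fraction 1 a F) /\
  (forall a : nat -> C,
     (forall r : nat, (1 <= r)%nat ->
        a (2 * r - 1)%nat = RtoC (INR ((3 * r - 1) ^ 2 * (3 * r))) /\
        a (2 * r)%nat = RtoC (INR ((3 * r) * (3 * r + 1) ^ 2))) ->
     exists F : fps,
       is_laplace_transform (fun u : C => (sm u * cm u)%C) F /\
       is_continued_fraction 2 a F).
Proof.
destruct sm_analytic as [s' Hs], cm_analytic as [c' Hc].
set (s := (fun n => s' n / RtoC (INR (fact n))) : fps).
set (c := (fun n => c' n / RtoC (INR (fact n))) : fps).
change (has_taylor sm s) in Hs. change (has_taylor cm c) in Hc.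
assert (H : is_formal_sm_cm s c).
{ repeat split.
  - apply (has_taylor_derive sm (fun u => cm u ^ 2)); [exact Hs| |exact sm_derive].
    apply (has_taylor_ext (fun u => cm u * cm u)); [intro; simpl; ring|].
    now apply has_taylor_mul.
  - apply (has_taylor_derive cm (fun u => - (sm u ^ 2))); [exact Hc| |exact cm_derive].
    apply (has_taylor_ext (fun u => - (sm u * sm u))); [intro; simpl; ring|].
    now apply has_taylor_opp, has_taylor_mul.
  - now rewrite (has_taylor_0 sm s Hs).
  - now rewrite (has_taylor_0 cm c Hc). }
(* The numerators are given for [r >= 1] with truncated subtraction; passing to [S r] removes it and
   matches the formal lemmas, indexed from 0. *)
assert (E : forall r : nat, (3 * S r = 3 * r + 3 /\ 3 * S r - 1 = 3 * r + 2
  /\ 3 * S r - 2 = 3 * r + 1)%nat) by (intros r; lia).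
repeat split; intros a Ha.
- exists (formal_laplace (fps_borel_inv s)). split.
  + exists (fps_borel_inv s). split; [now apply has_expansion_borel_inv|reflexivity].
  + apply (formal_sm_continued_fraction s c a H); intros r; destruct (E r) as (E0 & E1 & E2).
    * replace (2 * r + 1)%nat with (2 * S r - 1)%nat by lia.
      rewrite (proj1 (Ha (S r) (le_n_S 0 r (Nat.le_0_l r)))), ?E1, ?E2, ?E0. apply (f_equal Cnat). simpl Nat.pow. ring.
    * replace (2 * r + 2)%nat with (2 * S r)%nat by lia.
      rewrite (proj2 (Ha (S r) (le_n_S 0 r (Nat.le_0_l r)))), ?E1, ?E2, ?E0. apply (f_equal Cnat). simpl Nat.pow. ring.
- exists (formal_laplace (fps_borel_inv (fps_pow s 0 * c)%fps)). split.
  + exists (fps_borel_inv (fps_pow s 0 * c)%fps). split; [|reflexivity].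
    apply has_expansion_borel_inv. simpl. now rewrite fps_mul_1_l.
  + apply (formal_sm_cm_continued_fraction s c a 0 H); [lia|..]; intros r;
      destruct (E r) as (E0 & E1 & E2).
    * replace (2 * r + 1)%nat with (2 * S r - 1)%nat by lia.
      rewrite (proj1 (Ha (S r) (le_n_S 0 r (Nat.le_0_l r)))), ?E1, ?E2, ?E0. apply (f_equal Cnat). simpl Nat.pow. ring.
    * replace (2 * r + 2)%nat with (2 * S r)%nat by lia.
      rewrite (proj2 (Ha (S r) (le_n_S 0 r (Nat.le_0_l r)))), ?E1, ?E2, ?E0. apply (f_equal Cnat). simpl Nat.pow. ring.
- exists (formal_laplace (fps_borel_inv (fps_pow s 1 * c)%fps)). split.
  + exists (fps_borel_inv (fps_pow s 1 * c)%fps). split; [|reflexivity].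
    apply has_expansion_borel_inv. replace (fps_pow s 1) with s by (simpl; ring).
    now apply has_taylor_mul.
  + apply (formal_sm_cm_continued_fraction s c a 1 H); [lia|..]; intros r;
      destruct (E r) as (E0 & E1 & E2).
    * replace (2 * r + 1)%nat with (2 * S r - 1)%nat by lia.
      rewrite (proj1 (Ha (S r) (le_n_S 0 r (Nat.le_0_l r)))), ?E1, ?E2, ?E0. apply (f_equal Cnat). simpl Nat.pow. ring.
    * replace (2 * r + 2)%nat with (2 * S r)%nat by lia.
      rewrite (proj2 (Ha (S r) (le_n_S 0 r (Nat.le_0_l r)))), ?E1, ?E2, ?E0. apply (f_equal Cnat). simpl Nat.pow. ring.
Qed.
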